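(* Suppose that for some $\theta^*\in\Theta$ we have $\hat u_{\theta^*}(x,v)=u_p(x,v)$ for each $x\in D$ and $v\in\mathbb{R}^q$. Further assume that the learned components are of the form $$\beta_{\theta_1}(x)=\sum_{k=1}^{K_1}\theta_k^1\,\beta_k(x),\qquad \alpha_{\theta_2}(x)=\sum_{k=1}^{K_2}\theta_k^2\,\alpha_k(x),$$ where $\theta_1=(\theta^1_1,\dots,\theta^1_{K_1})$, $\theta_2=(\theta^2_1,\dots,\theta^2_{K_2})$, and $\beta_k$ ($\mathbb{R}^q$-valued) and $\alpha_k$ ($\mathbb{R}^{q\times q}$-valued) are continuous functions of $x$, and that the sets $\{\beta_k\}_{k=1}^{K_1}$ and $\{\alpha_k\}_{k=1}^{K_2}$ are each linearly independent (as families of functions on $D$). Then $\theta^*$ is the unique global (and local) minimizer of the optimization problem $(\mathbf{P})\colon\min_{\theta\in\Theta}L(\theta)$; that is, $\theta^*$ is the only global minimizer of $L$ over $\Theta$ and the only local minimizer of $L$ over $\Theta$.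
   Context: Plant and model. Let $D\subset\mathbb{R}^n$ be compact. The plant is the square control-affine system $\dot x=f_p(x)+g_p(x)u$, $y=h_p(x)$, with state $x\in\mathbb{R}^n$, input $u\in\mathbb{R}^q$, output $y\in\mathbb{R}^q$, and $f_p\colon\mathbb{R}^n\to\mathbb{R}^n$, $g_p\colon\mathbb{R}^n\to\mathbb{R}^{n\times q}$, $h_p\colon\mathbb{R}^n\to\mathbb{R}^q$ smooth. The nominal model is another such smooth system $\dot x=f_m(x)+g_m(x)u$, $y=h_m(x)$. Each has a well-defined vector relative degree on $D$, and the two relative degrees are equal to a common $(\gamma_1,\dots,\gamma_q)$. That is, for the plant, writing $g_{p,i}$ for the $i$-th column of $g_p$, $h_{p,j}$ for the $j$-th component of $h_p$, and $L_fh=\frac{dh}{dx}f$ for the Lie derivative, $\gamma_j$ is the number of times $y_j$ must be differentiated for at least one input to appear ($L_{g_{p,i}}L_{f_p}^k h_{p,j}\equiv 0$ on $D$ for all $i$ and $0\le k<\gamma_j-1$), so that $$[y_1^{(\gamma_1)},\dots,y_q^{(\gamma_q)}]^T=b_p(x)+A_p(x)u,$$ where $b_p(x)\in\mathbb{R}^q$ has entries $L_{f_p}^{\gamma_j}h_{p,j}(x)$ and $A_p(x)\in\mathbb{R}^{q\times q}$ has $(j,i)$ entry $L_{g_{p,i}}L_{f_p}^{\gamma_j-1}h_{p,j}(x)$, and $A_p(x)$ is invertible (bounded away from singularity) for $x\in D$. The same holds for the model with $b_m,A_m$. Linearizing controllers. The linearizing controller of the plant is $u_p(x,v)=A_p^{-1}(x)(-b_p(x)+v)$.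 The linearizing controller of the model is $u_m(x,v)=\beta_m(x)+\alpha_m(x)v$ with $\beta_m=-A_m^{-1}b_m$, $\alpha_m=A_m^{-1}$; if no nominal model is available one sets $\beta_m\equiv 0$, $\alpha_m\equiv0$. Learned controller. $\Theta_1\subset\mathbb{R}^{K_1}$ and $\Theta_2\subset\mathbb{R}^{K_2}$ are convex sets, $\Theta=\Theta_1\times\Theta_2$, $\theta=(\theta_1,\theta_2)\in\Theta$. With $\beta_{\theta_1}(x)\in\mathbb{R}^q$ and $\alpha_{\theta_2}(x)\in\mathbb{R}^{q\times q}$ parameterized functions (of the form given in the claim), the learned controller is $$\hat u_\theta(x,v)=[\beta_m(x)+\beta_{\theta_1}(x)]+[\alpha_m(x)+\alpha_{\theta_2}(x)]v .$$ Loss. Let $W_\theta(x,v)=b_p(x)+A_p(x)\hat u_\theta(x,v)$ and $\ell(x,v,\theta)=\|v-W_\theta(x,v)\|_2^2$. Let $X$ be a probability distribution on $\mathbb{R}^n$ with support $D$ and $V$ the uniform distribution on $\{v\in\mathbb{R}^q:\|v\|\le1\}$. Define $L(\theta)=\mathbb{E}_{x\sim X,\,v\sim V}\,\ell(x,v,\theta)$. *)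

(* Defs.v *)
From HB Require Import structures.
From mathcomp Require Import all_boot all_order all_algebra.
From mathcomp Require Import all_classical all_reals all_analysis.
Set Implicit Arguments.
Unset Strict Implicit.
Unset Printing Implicit Defensive.
Import Order.TTheory GRing.Theory Num.Theory.
Import numFieldNormedType.Exports.
Local Open Scope classical_set_scope.
Local Open Scope ring_scope.

(* R^n is 'cV[R]_n throughout.  The library norm on matrices is the sup norm:
   it is only used through the (norm-independent) topology, differentiability
   and Borel sets; [norm2] is the Euclidean norm. *)
Definition norm2 (R : realType) (n : nat) (v : 'cV[R]_n) : R :=
  Num.sqrt (\sum_(i < n) v i ord0 ^+ 2).

Definition unit_ball2 (R : realType) (n : nat) : set 'cV[R]_n :=
  [set v | norm2 v <= 1].

(* f is C^(k+1) iff it is differentiable everywhere and, for each fixed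
   direction v, x |-> df_x(v) is C^k. *)
Fixpoint class_C (R : realType) (U W : normedModType R) (k : nat)
    (f : U -> W) : Prop :=
  if k is k'.+1 then
    (forall x, differentiable f x) /\
    (forall v : U, class_C k' (fun x => 'd f x v))
  else continuous f.

Definition smooth (R : realType) (U W : normedModType R) (f : U -> W) : Prop :=
  forall k, class_C k f.

Definition lie (R : realType) (U W : normedModType R) (f : U -> U)
    (h : U -> W) : U -> W :=
  fun x => 'd h x (f x).

(* The square system  x' = drift x + input x *m u,  y = output x. *)
Record control_system (R : realType) (n q : nat) := ControlSystem {
  drift : 'cV[R]_n -> 'cV[R]_n ;
  input : 'cV[R]_n -> 'M[R]_(n, q) ;
  output : 'cV[R]_n -> 'cV[R]_q
}.

Definition smooth_system (R : realType) (n q : nat)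
    (sys : control_system R n q) : Prop :=
  [/\ smooth (drift sys), smooth (input sys) & smooth (output sys)].

Definition input_field (R : realType) (n q : nat) (sys : control_system R n q)
    (i : 'I_q) : 'cV[R]_n -> 'cV[R]_n :=
  fun x => col i (input sys x).

Definition output_comp (R : realType) (n q : nat) (sys : control_system R n q)
    (j : 'I_q) : 'cV[R]_n -> R^o :=
  fun x => output sys x j ord0.

Definition drift_term (R : realType) (n q : nat) (sys : control_system R n q)
    (gamma : 'I_q -> nat) (x : 'cV[R]_n) : 'cV[R]_q :=
  \col_j iter (gamma j) (lie (drift sys)) (output_comp sys j) x.

Definition decoupling_mx (R : realType) (n q : nat) (sys : control_system R n q)
    (gamma : 'I_q -> nat) (x : 'cV[R]_n) : 'M[R]_q :=
  \matrix_(j, i)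
    lie (input_field sys i)
        (iter (gamma j).-1 (lie (drift sys)) (output_comp sys j)) x.

(* On the compact set D the determinant bound amounts to the decoupling matrix
   being bounded away from singularity; there it follows from invertibility. *)
Definition vector_relative_degree (R : realType) (n q : nat)
    (sys : control_system R n q) (D : set 'cV[R]_n) (gamma : 'I_q -> nat)
    : Prop :=
  [/\ forall j, (0 < gamma j)%N,
      forall i j k x, (k < (gamma j).-1)%N -> D x ->
        lie (input_field sys i)
            (iter k (lie (drift sys)) (output_comp sys j)) x = 0
    & exists2 c : R, 0 < c &
        forall x, D x -> decoupling_mx sys gamma x \in unitmx /\
                         c <= `|\det (decoupling_mx sys gamma x)| ].

Definition linearizing_controller (R : realType) (n q : nat)
    (sys : control_system R n q) (gamma : 'I_q -> nat)
    (x : 'cV[R]_n) (v : 'cV[R]_q) : 'cV[R]_q :=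
  invmx (decoupling_mx sys gamma x) *m (- drift_term sys gamma x + v).

(* [None] is the case where no nominal model is available. *)
Definition model_beta (R : realType) (n q : nat)
    (model : option (control_system R n q)) (gamma : 'I_q -> nat)
    (x : 'cV[R]_n) : 'cV[R]_q :=
  if model is Some sys then
    - (invmx (decoupling_mx sys gamma x) *m drift_term sys gamma x)
  else 0.

Definition model_alpha (R : realType) (n q : nat)
    (model : option (control_system R n q)) (gamma : 'I_q -> nat)
    (x : 'cV[R]_n) : 'M[R]_q :=
  if model is Some sys then invmx (decoupling_mx sys gamma x) else 0.

Definition lin_comb (R : realType) (T : Type) (W : lmodType R) (K : nat)
    (c : 'cV[R]_K) (F : 'I_K -> T -> W) (x : T) : W :=
  \sum_(k < K) c k ord0 *: F k x.

Definition lin_indep_on (R : realType) (T : Type) (W : lmodType R) (K : nat)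
    (D : set T) (F : 'I_K -> T -> W) : Prop :=
  forall c : 'cV[R]_K, (forall x, D x -> lin_comb c F x = 0) -> c = 0.

Definition learned_controller (R : realType) (n q K1 K2 : nat)
    (model : option (control_system R n q)) (gamma : 'I_q -> nat)
    (beta : 'I_K1 -> 'cV[R]_n -> 'cV[R]_q)
    (alpha : 'I_K2 -> 'cV[R]_n -> 'M[R]_q)
    (theta : 'cV[R]_K1 * 'cV[R]_K2) (x : 'cV[R]_n) (v : 'cV[R]_q)
    : 'cV[R]_q :=
  (model_beta model gamma x + lin_comb theta.1 beta x) +
  (model_alpha model gamma x + lin_comb theta.2 alpha x) *m v.

Definition pointwise_loss (R : realType) (n q : nat)
    (plant : control_system R n q) (gamma : 'I_q -> nat)
    (u : 'cV[R]_n -> 'cV[R]_q -> 'cV[R]_q)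
    (x : 'cV[R]_n) (v : 'cV[R]_q) : R :=
  norm2 (v - (drift_term plant gamma x + decoupling_mx plant gamma x *m u x v))
    ^+ 2.

Definition borel (R : realType) (n : nat) :=
  g_sigma_algebraType (@open 'cV[R]_n).

Definition prob_support (R : realType) (n : nat) (P : probability (borel R n) R)
    : set 'cV[R]_n :=
  [set x | forall U : set 'cV[R]_n, open U -> U x -> (0 < P U)%E].

(* Lebesgue measure of a Borel set of R^n, as the n-fold product of the
   one-dimensional Lebesgue measure: the recursion is the section formula
   that defines product measures. *)
Fixpoint lebesgueRn (R : realType) (n : nat) : set 'cV[R]_n -> \bar R :=
  match n return set 'cV[R]_n -> \bar R with
  | 0%N => fun A => (\1_A (0 : 'cV[R]_0))%:E
  | m.+1 => fun A =>
      (\int[@lebesgue_measure R]_t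
         lebesgueRn [set v : 'cV[R]_m |
                       A (col_mx (const_mx t : 'cV[R]_1) v)])%E
  end.

Definition uniform_on (R : realType) (n : nat) (P : probability (borel R n) R)
    (B : set 'cV[R]_n) : Prop :=
  forall A : set (borel R n), measurable A ->
    P A = (lebesgueRn (A `&` B) / lebesgueRn B)%E.

Definition expected_loss (R : realType) (n q K1 K2 : nat)
    (plant : control_system R n q) (model : option (control_system R n q))
    (gamma : 'I_q -> nat)
    (beta : 'I_K1 -> 'cV[R]_n -> 'cV[R]_q)
    (alpha : 'I_K2 -> 'cV[R]_n -> 'M[R]_q)
    (X : probability (borel R n) R) (V : probability (borel R q) R)
    (theta : 'cV[R]_K1 * 'cV[R]_K2) : \bar R :=
  ('E_(X \x V)[fun z : borel R n * borel R q =>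
     pointwise_loss plant gamma
       (learned_controller model gamma beta alpha theta) z.1 z.2])%E.

Definition global_minimizer (R : realType) (T : Type) (C : set T)
    (L : T -> \bar R) (t : T) : Prop :=
  C t /\ forall s, C s -> (L t <= L s)%E.

Definition local_minimizer (R : realType) (T : topologicalType) (C : set T)
    (L : T -> \bar R) (t : T) : Prop :=
  C t /\ \forall s \near within C (nbhs t), (L t <= L s)%E.

(* Main.v *)
Require Import Defs.
From HB Require Import structures.
From mathcomp Require Import all_boot all_order all_algebra.
From mathcomp Require Import all_classical all_reals all_analysis.
From mathcomp Require Import measurable_realfun.
From mathcomp Require Import lra.
Set Implicit Arguments.
Unset Strict Implicit.
Unset Printing Implicit Defensive.
Import Order.TTheory GRing.Theory Num.Theory.
Import numFieldNormedType.Exports.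
Local Open Scope classical_set_scope.
Local Open Scope ring_scope.

(** Write A for the decoupling matrix of the plant and d for the difference
    t - theta of a parameter and the exact one.  On D the plant output under
    the exact controller is v itself, so the residual of the parameter t is the
    A-image of the controller mismatch, and the mismatch is linear in d:
    the pointwise loss is |A(x) (b_d(x) + a_d(x) v)|^2, where b_d and a_d are
    the linear combinations of the beta_k and alpha_k with coefficients d
    ([pointwise_loss_residual]).  The measures X and V do not charge the
    complements of D and of the unit ball ([prob_support_full],
    [uniform_unit_ball2_out]), so the expected loss L(t) is the integral of
    this expression.  Three facts about the integral give the theorem.

    - It is positive unless d = 0 ([expected_residual_gt0]).  By linear
      independence b_d or a_d is nonzero at some x0 of D; the affine map
      v |-> b_d(x0) + a_d(x0) v is then nonzero at points arbitrarily close
      to 0, and A(x0) is invertible.  By continuity the loss stays above a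
      positive constant on a product of neighbourhoods, which has positive
      measure because x0 is in the support of X and V charges every small cube
      inside the ball.
    - It is finite ([expected_residual_lty]), being the integral of a continuous
      function over the compact set D times the unit ball.
    - It is homogeneous of degree 2 in d.

    Hence moving from t towards theta along the segment, which stays in the
    convex set of parameters, multiplies L by k^2 < 1 and strictly decreases it
    at once: a point other than theta is not even a local minimizer
    ([segment_descent_minimizers]).

    Continuity of the loss needs continuity of A, whose entries are iterated Lie
    derivatives; smoothness is preserved by the Lie derivative because in
    coordinates it is a sum of products of smooth functions ([smooth_lie]). *)

(** * Comparing integrals of arbitrary nonnegative functions *)

(** The integral of a nonnegative function is the supremum of the integrals of
    the simple functions below it.  Monotonicity and subhomogeneity follow from
    this description alone, so they are proved for all nonnegative functions;
    they get applied to the sections in the definition of [lebesgueRn] and to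
    the loss outside of D. *)
Section lower_integral.
Context d (T : measurableType d) (R : realType).
Variable mu : {measure set T -> \bar R}.
Local Open Scope ereal_scope.
Import HBNNSimple.

(** A simple function below f, once set to 0 on the null set N, lies below g
    and keeps its integral. *)
Lemma ge0_le_integral_off_null (N : set T) (f g : T -> \bar R) :
  measurable N -> mu N = 0 ->
  (forall x, 0 <= f x) -> (forall x, 0 <= g x) ->
  (forall x, ~ N x -> f x <= g x) ->
  \int[mu]_x f x <= \int[mu]_x g x.
Proof.
move=> mN muN f0 g0 fg; rewrite !ge0_integralTE//.
apply: ge_ereal_sup => _ [h /= hf <-].
have mNC : measurable (~` N) by exact: measurableC.
apply: ereal_sup_ubound.
exists (mul_nnsfun h (indic_nnsfun R mNC)) => /=.
  move=> x; change (((h x * \1_(~` N) x)%R)%:E <= g x).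
  rewrite indicE; have [Nx|Nx] := pselect (N x).
    by rewrite memNset ?mulr0//=; apply.
  by rewrite mem_set// mulr1; apply: le_trans (hf x) (fg x Nx).
rewrite -[RHS]integralT_nnsfun (ge0_negligible_integral mN)//; last first.
- by move=> x _; rewrite lee_fin.
- exact/measurable_EFinP.
rewrite setTD integral_nnsfun//; congr (sintegral mu _).
by rewrite mrestrict.
Qed.

Lemma ge0_le_integral_lower (f g : T -> \bar R) :
  (forall x, 0 <= f x) -> (forall x, f x <= g x) ->
  \int[mu]_x f x <= \int[mu]_x g x.
Proof.
move=> f0 fg; apply: (@ge0_le_integral_off_null set0) => // x.
exact: le_trans (fg x).
Qed.

Lemma ge0_integralZl_le (k : R) (f : T -> \bar R) :
  (0 < k)%R -> (forall x, 0 <= f x) ->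
  \int[mu]_x (k%:E * f x) <= k%:E * \int[mu]_x f x.
Proof.
move=> k0 f0; rewrite !ge0_integralTE//; last first.
  by move=> x; rewrite mule_ge0// lee_fin ltW.
have ki0 : (0 <= k^-1)%R by rewrite invr_ge0 ltW.
apply: ge_ereal_sup => _ [h /= hf <-].
rewrite -lee_pdivrMl// -sintegralrM; apply: ereal_sup_ubound.
exists (scale_nnsfun h ki0) => //= x.
by rewrite EFinM lee_pdivrMl.
Qed.

End lower_integral.

(** * Lebesgue measure of cubes *)

Section lebesgueRn_theory.
Variable R : realType.

Lemma lebesgueRn_ge0 n (A : set 'cV[R]_n) : (0 <= lebesgueRn A)%E.
Proof.
by elim: n A => [A|n IH A] /=; [rewrite lee_fin|apply: integral_ge0].
Qed.

Lemma lebesgueRn_set0 n : lebesgueRn (@set0 'cV[R]_n) = 0%E.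
Proof.
elim: n => [|n IH] /=; first by rewrite indic0.
by apply: integral0_eq => t _; rewrite -[RHS]IH.
Qed.

Lemma le_lebesgueRn n (A B : set 'cV[R]_n) :
  A `<=` B -> (lebesgueRn A <= lebesgueRn B)%E.
Proof.
elim: n A B => [A B AB|n IH A B AB] /=.
  rewrite lee_fin !indicE; case: (boolP (_ \in A)) => //.
  by rewrite inE => /AB H; rewrite mem_set.
apply: ge0_le_integral_lower => [t|t]; first exact: lebesgueRn_ge0.
by apply: IH => v; apply: AB.
Qed.

Definition cube n (a : 'cV[R]_n) (r : R) : set 'cV[R]_n :=
  [set v | forall i, `|a i ord0 - v i ord0| < r].

(** The bound is an equality, but the inequality is what the recursion gives
    without discussing finiteness: the section of the cube at t contains a cube of
    the same radius as soon as t is within r of the first coordinate. *)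
Lemma lebesgueRn_cube_ge n (a : 'cV[R]_n) (r : R) : 0 < r ->
  (((r *+ 2) ^+ n)%:E <= lebesgueRn (cube a r))%E.
Proof.
move=> r0; elim: n a => [a|n IH a] /=.
  by rewrite expr0 lee_fin indicE mem_set// => -[].
have mI : measurable (ball (a ord0 ord0) r : set R).
  by rewrite ball_itv; apply: measurable_itv.
pose c := (r *+ 2) ^+ n.
have c0 : 0 <= c by rewrite exprn_ge0// mulrn_wge0// ltW.
apply: (@le_trans _ _ (\int[@lebesgue_measure R]_t
   (c%:E * (\1_(ball (a ord0 ord0) r) t)%:E))%E).
  rewrite ge0_integralZl//; last first.
    by apply: measurableT_comp => //; exact: measurable_indic.
  rewrite integral_indic// setIT.
  rewrite [X in (_ * X)%E](_ : _ = (r *+ 2)%:E) -?EFinM ?exprSr//.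
  by apply: lebesgue_measure_ball; exact: ltW.
apply: ge0_le_integral_lower => t.
  by rewrite mule_ge0// lee_fin.
rewrite indicE; have [ta|ta] := pselect (ball (a ord0 ord0) r t); last first.
  by rewrite memNset// mule0 lebesgueRn_ge0.
rewrite mem_set// mule1.
apply: (le_trans (IH (dsubmx (a : 'cV_(1 + n))))).
apply: le_lebesgueRn => v /= vB i.
case: (@split_ordP 1 n i) => j ->.
  have -> : col_mx (const_mx t : 'cV_1) v (lshift n j) ord0 = t.
    by rewrite (col_mxEu (const_mx t : 'cV_1)) mxE.
  by rewrite (_ : lshift n j = ord0 :> 'I_(1 + n))// ord1; exact: val_inj.
have -> : col_mx (const_mx t : 'cV_1) v (rshift 1 j) ord0 = v j ord0.
  by rewrite (col_mxEd (const_mx t : 'cV_1)).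
by have := vB j; rewrite mxE.
Qed.

Lemma lebesgueRn_cube_gt0 n (a : 'cV[R]_n) (r : R) : 0 < r ->
  (0 < lebesgueRn (cube a r))%E.
Proof.
move=> r0; apply: lt_le_trans (lebesgueRn_cube_ge a r0).
by rewrite lte_fin exprn_gt0// mulrn_wgt0.
Qed.

End lebesgueRn_theory.

(** * Lie derivatives of smooth functions *)

Section smooth_calculus.
Variable R : realType.

Section class_C.
Variable U : normedModType R.
Implicit Types f g : U -> R^o.

Lemma class_C_cst k (c : R^o) : class_C k (fun _ : U => c).
Proof.
elim: k c => [|k IH] c /=; first by move=> x; exact: cvg_cst.
split=> [x|v]; first exact: differentiable_cst.
rewrite (_ : (fun _ => _) = fun=> 0) //.
by apply/funext => x; rewrite (@diff_cst _ U R^o c x).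
Qed.

Lemma class_CD k f g :
  class_C k f -> class_C k g -> class_C k (fun x => f x + g x : R^o).
Proof.
elim: k f g => [|k IH] f g /=; first by move=> cf cg x; exact: cvgD (cf x) (cg x).
move=> [df Cf] [dg Cg]; split=> [x|v]; first exact: differentiableD.
rewrite (_ : (fun _ => _) = fun x => 'd f x v + 'd g x v); first exact: IH.
by apply/funext => x; rewrite (diffD (df x) (dg x)).
Qed.

Lemma class_C_sum k m (f : 'I_m -> U -> R^o) :
  (forall i, class_C k (f i)) -> class_C k (fun x => \sum_(i < m) f i x : R^o).
Proof.
elim: m f => [|m IH] f Cf.
  rewrite (_ : (fun _ => _) = fun=> 0); first exact: class_C_cst.
  by apply/funext => x; rewrite big_ord0.
rewrite (_ : (fun _ => _) =
  fun x => f ord0 x + \sum_(i < m) f (lift ord0 i) x : R^o).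
  by apply: class_CD => //; apply: IH.
by apply/funext => x; rewrite big_ord_recl.
Qed.

(** Differentiable functions are continuous; this starts the induction and lets
    the product rule below mix f with the derivative of g. *)
Lemma class_C_pred k f : class_C k.+1 f -> class_C k f.
Proof.
elim: k f => [|k IH] f [df Cf]; first by move=> x; exact: differentiable_continuous.
by split=> // v; apply: IH; exact: Cf.
Qed.

Lemma class_CM k f g :
  class_C k f -> class_C k g -> class_C k (fun x => f x * g x : R^o).
Proof.
elim: k f g => [|k IH] f g; first by move=> cf cg x; exact: cvgM (cf x) (cg x).
move=> CSf CSg.
case: (CSf) => df Cf; case: (CSg) => dg Cg; split=> [x|v].
  exact: (@differentiableM _ _ (f : U -> R) (g : U -> R)).
rewrite (_ : (fun _ => _) = fun x => f x * 'd g x v + g x * 'd f x v).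
  apply: class_CD; apply: IH.
  - exact: class_C_pred CSf.
  - exact: Cg.
  - exact: class_C_pred CSg.
  - exact: Cf.
apply/funext => x.
by rewrite (@diffM _ _ (f : U -> R) (g : U -> R) x (df x) (dg x)).
Qed.

(** A coordinate c is linear and continuous, hence its own differential, and
    the chain rule gives d(c o f) = c o df. *)
Lemma class_C_coord k m p (f : U -> 'M[R]_(m, p)) i j :
  class_C k f -> class_C k (fun x => f x i j : R^o).
Proof.
pose c (M : 'M[R]_(m, p)) : R^o := M i j.
have c_lin : linear c by move=> a M N; rewrite /c !mxE.
pose cL : {linear 'M[R]_(m, p) -> R^o} :=
  HB.pack c (GRing.isLinear.Build _ _ _ _ _ c_lin).
have c_cont : continuous c by exact: coord_continuous.
elim: k f => [|k IH] f.
  by move=> cf x; apply: (@continuous_comp _ _ _ f c); [exact: cf|exact: c_cont].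
have dc x : differentiable c x := linear_differentiable (f := cL) x c_cont.
move=> [df Cf]; split=> [x|v].
  exact: (@differentiable_comp _ _ _ _ f c).
rewrite (_ : (fun _ => _) = fun x => ('d f x v) i j); first exact: (IH _ (Cf v)).
apply/funext => x; rewrite (@diff_comp _ _ _ _ f c)//=.
by rewrite (diff_lin (f := cL) _ c_cont).
Qed.

End class_C.

Lemma smooth_continuous (U W : normedModType R) (f : U -> W) :
  smooth f -> continuous f.
Proof. by move=> /(_ 0%N). Qed.

(** In coordinates, L_f h is the sum over j of f_j times the derivative of h in
    the fixed direction e_j; [class_C] controls exactly such directional
    derivatives. *)
Lemma lie_sum n (f : 'cV[R]_n -> 'cV[R]_n) (h : 'cV[R]_n -> R^o) x :
  lie f h x = \sum_(j < n) f x j ord0 * 'd h x (delta_mx j ord0).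
Proof.
rewrite /lie {1}(matrix_sum_delta (f x)) linear_sum; apply: eq_bigr => j _.
by rewrite big_ord1 linearZ.
Qed.

Lemma smooth_lie n (f : 'cV[R]_n -> 'cV[R]_n) (h : 'cV[R]_n -> R^o) :
  (forall j, smooth (fun x => f x j ord0 : R^o)) -> smooth h ->
  smooth (lie f h).
Proof.
move=> Cf Ch k; rewrite (funext (lie_sum f h)).
apply: class_C_sum => j; apply: class_CM; first exact: Cf.
by have [_] := Ch k.+1; apply.
Qed.

Lemma decoupling_mx_continuous n q (sys : control_system R n q)
    (gamma : 'I_q -> nat) i j : smooth_system sys ->
  continuous (fun x => decoupling_mx sys gamma x i j : R).
Proof.
move=> [Cf Cg Ch].
rewrite (_ : (fun _ => _) = lie (input_field sys j)
   (iter (gamma i).-1 (lie (drift sys)) (output_comp sys i))); last first.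
  by apply/funext => x; rewrite mxE.
apply: smooth_continuous; apply: smooth_lie.
  move=> l; rewrite (_ : (fun _ => _) = fun x => input sys x l j : R^o).
    by move=> k; apply: class_C_coord; exact: Cg.
  by apply/funext => x; rewrite mxE.
elim: (gamma i).-1 => [k|m IH] /=; first by apply: class_C_coord; exact: Ch.
by apply: smooth_lie => // l k; apply: class_C_coord; exact: Cf.
Qed.

End smooth_calculus.

(** * Continuity of matrix-valued functions *)

Lemma continuous_sum_ord (R : realType) (T : topologicalType) m
    (f : 'I_m -> T -> R) :
  (forall i, continuous (f i)) -> continuous (fun x => \sum_(i < m) f i x).
Proof.
elim: m f => [|m IH] f cf.
  rewrite (_ : (fun _ => _) = fun=> 0); first by move=> x; exact: cvg_cst.
  by apply/funext => x; rewrite big_ord0.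
rewrite (_ : (fun _ => _) =
  fun x => f ord0 x + \sum_(i < m) f (lift ord0 i) x).
  by move=> x; apply: cvgD; [exact: cf|apply: (IH (fun i => f (lift ord0 i)))].
by apply/funext => x; rewrite big_ord_recl.
Qed.

Definition mx_continuous (R : realType) (T : topologicalType) m p
    (M : T -> 'M[R]_(m, p)) : Prop :=
  forall i j, continuous (fun x => M x i j).

Section mx_continuity.
Variables (R : realType) (T : topologicalType).

Lemma continuous_mx_continuous m p (M : T -> 'M[R]_(m, p)) :
  continuous M -> mx_continuous M.
Proof.
move=> cM i j x; apply: (@continuous_comp _ _ _ M (fun N : 'M[R]_(m, p) => N i j)).
  exact: cM.
exact: coord_continuous.
Qed.

Lemma mx_continuousD m p (M N : T -> 'M[R]_(m, p)) :
  mx_continuous M -> mx_continuous N -> mx_continuous (fun x => M x + N x).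
Proof.
move=> cM cN i j; rewrite (_ : (fun _ => _) = fun x => M x i j + N x i j).
  by move=> x; apply: cvgD; [exact: cM|exact: cN].
by apply/funext => x; rewrite mxE.
Qed.

Lemma mx_continuousM m p r (M : T -> 'M[R]_(m, p)) (N : T -> 'M[R]_(p, r)) :
  mx_continuous M -> mx_continuous N -> mx_continuous (fun x => M x *m N x).
Proof.
move=> cM cN i j.
rewrite (_ : (fun _ => _) = fun x => \sum_k M x i k * N x k j).
  apply: continuous_sum_ord => k x.
  by apply: cvgM; [exact: cM|exact: cN].
by apply/funext => x; rewrite mxE.
Qed.

Lemma mx_continuous_lin_comb m p K (c : 'cV[R]_K) (F : 'I_K -> T -> 'M[R]_(m, p)) :
  (forall k, continuous (F k)) -> mx_continuous (lin_comb c F).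
Proof.
move=> cF i j.
rewrite (_ : (fun _ => _) = fun x => \sum_(k < K) c k ord0 * F k x i j).
  apply: continuous_sum_ord => k x; apply: cvgM; first exact: cvg_cst.
  exact: continuous_mx_continuous.
by apply/funext => x; rewrite /lin_comb summxE; under eq_bigr do rewrite mxE.
Qed.

Lemma mx_continuous_comp (S : topologicalType) (f : S -> T) m p
    (M : T -> 'M[R]_(m, p)) :
  continuous f -> mx_continuous M -> mx_continuous (M \o f).
Proof.
move=> cf cM i j x; apply: (@continuous_comp _ _ _ f (fun y => M y i j)).
  exact: cf.
exact: cM.
Qed.

End mx_continuity.

(** * Supports of Borel probability measures on R^n *)

Section borel_probability.
Variables (R : realType) (n : nat).

Lemma cubeE (a : 'cV[R]_n) (r : R) : 0 < r -> cube a r = ball a r.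
Proof.
move=> r0; apply/seteqP; split=> v /=.
  by move=> av; split=> // i j; rewrite ord1; exact: av.
by move=> [_ av] i; exact: av.
Qed.

Lemma open_cube (a : 'cV[R]_n) (r : R) : 0 < r -> open (cube a r).
Proof. by move=> r0; rewrite cubeE//; exact: ball_open. Qed.

Lemma nbhs_cube (a : 'cV[R]_n) (U : set 'cV[R]_n) :
  nbhs a U -> exists2 r, 0 < r & cube a r `<=` U.
Proof. by move=> /nbhs_ballP[r r0 rU]; exists r => //; rewrite cubeE. Qed.

Lemma borel_open (U : set 'cV[R]_n) : open U -> measurable (U : set (borel R n)).
Proof. by move=> oU; exact: sub_sigma_algebra. Qed.

Lemma borel_closed (F : set 'cV[R]_n) :
  closed F -> measurable (F : set (borel R n)).
Proof.
move=> cF; rewrite -(setCK F).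
by apply: measurableC; apply: borel_open; exact: closed_openC.
Qed.

Lemma ratr_cube_approx (x : 'cV[R]_n) (e : R) : 0 < e ->
  exists c : 'cV[rat]_n, cube (map_mx ratr c) e x.
Proof.
move=> e0.
have ex i : exists c : rat, `|ratr c - x i ord0| < e.
  have /rat_in_itvoo[c] : x i ord0 - e < x i ord0 + e by lra.
  rewrite in_itv/= => /andP[c1 c2]; exists c.
  by rewrite ltr_norml; apply/andP; split; lra.
exists (\col_i projT1 (cid (ex i))) => i; rewrite !mxE.
by case: cid.
Qed.

Lemma closed_prob_support (P : probability (borel R n) R) :
  closed (prob_support P).
Proof.
move=> x clx U oU Ux.
have [y [Sy Uy]] := clx U (open_nbhs_nbhs (conj oU Ux)).
exact: Sy.
Qed.

(** Each point outside the support lies in a null open set, hence in a null cube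
    with rational centre and radius 1/(k+1); there are countably many of
    these. *)
Lemma prob_support_full (P : probability (borel R n) R) :
  P (~` prob_support P) = 0%E.
Proof.
pose F (ck : 'cV[rat]_n * nat) : set (borel R n) :=
  let B := cube (map_mx ratr ck.1) ck.2.+1%:R^-1 in
  if P B == 0%E then B else set0.
pose G m := if unpickle m is Some ck then F ck else set0.
apply: measure_negligible.
  by apply: measurableC; apply: borel_closed; exact: closed_prob_support.
apply: (@negligibleS _ _ _ _ (\bigcup_m G m)); last first.
  apply: negligible_bigcup => m; rewrite /G.
  case: (unpickle m) => [ck|]; last exact: negligible_set0.
  rewrite /F; case: ifPn => [/eqP P0|_]; last exact: negligible_set0.
  apply/negligibleP => //; apply: borel_open; apply: open_cube.
  by rewrite invr_gt0.
move=> x /= /existsNP[U] /not_implyP[oU] /not_implyP[Ux /negP].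
rewrite -leNgt => PU0.
have [r r0 rU] := nbhs_cube (open_nbhs_nbhs (conj oU Ux)).
(* A cube of radius e containing x lies within 2e of x. *)
have [k kr] : exists k, k.+1%:R^-1 < r / 2.
  exists (Num.truncn (r / 2)^-1).
  rewrite -[ltRHS]invrK ltf_pV2 ?posrE ?invr_gt0 ?divr_gt0//.
  exact: truncnS_gt.
have k0 : 0 < k.+1%:R^-1 :> R by rewrite invr_gt0.
have [c cx] := ratr_cube_approx x k0.
exists (pickle (c, k)) => //; rewrite /G pickleK /F /=.
suff -> : P (cube (map_mx ratr c) k.+1%:R^-1) == 0%E by [].
rewrite eq_le measure_ge0 andbT (le_trans _ PU0)// le_measure ?inE//.
- by apply: borel_open; exact: open_cube.
- exact: borel_open.
move=> y /= cy; apply: rU => i.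
move: (k.+1%:R^-1) kr (cx i) (cy i) => e er.
rewrite !ltr_norml => /andP[? ?] /andP[? ?].
by apply/andP; split; lra.
Qed.

End borel_probability.

(** * The uniform distribution on the Euclidean unit ball *)

Section unit_ball.
Variables (R : realType) (q : nat).

Lemma norm2_sqr (v : 'cV[R]_q) : norm2 v ^+ 2 = \sum_(i < q) v i ord0 ^+ 2.
Proof. by rewrite sqr_sqrtr// sumr_ge0// => i _; exact: sqr_ge0. Qed.

Lemma norm2_le1 (v : 'cV[R]_q) :
  (norm2 v <= 1) = (\sum_(i < q) v i ord0 ^+ 2 <= 1).
Proof. by rewrite -norm2_sqr expr_le1// sqrtr_ge0. Qed.

Lemma norm2_eq0 (v : 'cV[R]_q) : norm2 v = 0 -> v = 0.
Proof.
move=> v0; have /eqP := norm2_sqr v; rewrite v0 expr0n /= eq_sym.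
rewrite psumr_eq0 => [/allP v0'|i _]; last exact: sqr_ge0.
apply/colP => i; apply/eqP; rewrite mxE -sqrf_eq0.
by apply: v0'; rewrite mem_index_enum.
Qed.

Lemma continuous_sumsq :
  continuous (fun v : 'cV[R]_q => \sum_(i < q) v i ord0 ^+ 2).
Proof.
apply: continuous_sum_ord => i v.
apply: (@continuous_comp _ _ _ (fun v : 'cV[R]_q => v i ord0) (fun x => x ^+ 2)).
  exact: coord_continuous.
exact: exprn_continuous.
Qed.

Lemma closed_unit_ball2 : closed (@unit_ball2 R q).
Proof.
rewrite (_ : @unit_ball2 R q =
  (fun v : 'cV_q => \sum_(i < q) v i ord0 ^+ 2) @^-1` [set x | x <= 1]).
  by apply: preimage_closed; [move=> v _; exact: continuous_sumsq|exact: closed_le].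
by apply/seteqP; split=> v /=; rewrite /unit_ball2 /= norm2_le1.
Qed.

Lemma unit_ball2_coord (v : 'cV[R]_q) i : unit_ball2 v -> `|v i ord0| <= 1.
Proof.
rewrite /unit_ball2 /= norm2_le1 (bigD1 i)//= => v1.
rewrite -(@expr_le1 _ 2)// real_normK ?num_real//.
by apply: le_trans v1; rewrite lerDl sumr_ge0// => j _; exact: sqr_ge0.
Qed.

Lemma cube_sub_unit_ball2 :
  exists2 r : R, 0 < r & cube (0 : 'cV[R]_q) r `<=` @unit_ball2 R q.
Proof.
apply: nbhs_cube.
have c0 : \sum_(i < q) (0 : 'cV[R]_q) i ord0 ^+ 2 < 1.
  by rewrite big1// => i _; rewrite mxE expr0n.
have near0 : nbhs (0 : 'cV[R]_q)
    [set v : 'cV[R]_q | \sum_(i < q) v i ord0 ^+ 2 < 1].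
  exact: (@continuous_sumsq 0) (lt_nbhsl c0).
apply: filterS near0 => v /= /ltW.
by rewrite /unit_ball2 /= norm2_le1.
Qed.

Variable V : probability (borel R q) R.
Hypothesis uniform_V : uniform_on V (@unit_ball2 R q).

Lemma uniform_unit_ball2_out : V (~` @unit_ball2 R q) = 0%E.
Proof.
rewrite uniform_V; last first.
  by apply: measurableC; apply: borel_closed; exact: closed_unit_ball2.
by rewrite setICl lebesgueRn_set0 mul0e.
Qed.

(** Division in the extended reals is total, so the ball must be shown to have
    finite measure: an infinite value b would give V the total mass
    b / b = b * 0 = 0 instead of 1. *)
Lemma uniform_unit_ball2_cube_gt0 (a : 'cV[R]_q) (r : R) : 0 < r ->
  cube a r `<=` @unit_ball2 R q -> (0 < V (cube a r))%E.
Proof.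
move=> r0 sB; rewrite uniform_V; last first.
  by apply: borel_open; exact: open_cube.
rewrite (setIidl sB).
have c0 : (0 < lebesgueRn (cube a r))%E by exact: lebesgueRn_cube_gt0.
have := probability_setT V; rewrite uniform_V// setTI.
have := le_lebesgueRn sB; move/(lt_le_trans c0).
case: (lebesgueRn (@unit_ball2 R q)) => [b|_|//].
  rewrite lte_fin => b0 _.
  by rewrite mule_gt0// inver gt_eqF// lte_fin invr_gt0.
by rewrite invey mule0 => /eqP; rewrite eq_sym onee_eq0.
Qed.

End unit_ball.

Lemma compact_unit_ball2 (R : realType) (q : nat) : compact (@unit_ball2 R q).
Proof.
have trmx_cont : continuous (@trmx R 1 q).
  move=> M U /nbhs_ballP[e e0 eU]; apply/nbhs_ballP; exists e => // N [_ MN].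
  by apply: eU; split=> // i j; rewrite !mxE.
have cI : compact (@trmx R 1 q @`
    [set r : 'rV[R]_q | forall i, `[-1, 1]%classic (r ord0 i)]).
  apply: continuous_compact; first exact: continuous_subspaceT.
  apply: (@rV_compact R q (fun _ => `[-1, 1]%classic)) => _.
  exact: segment_compact.
have := @subclosed_compact _ _ _ (@closed_unit_ball2 R q) cI.
apply.
  move=> v v1; exists v^T; last exact: trmxK.
  move=> i /=; rewrite mxE in_itv/= -ler_norml.
  exact: unit_ball2_coord.
Qed.

(** * The residual and its expectation *)

(** With A the decoupling matrix and b, a the errors of the two parts of the
    controller, this is the squared distance of the closed-loop output from v. *)
Definition residual (R : realType) q (A : 'M[R]_q) (b : 'cV[R]_q) (a : 'M[R]_q)
    (v : 'cV[R]_q) : R := norm2 (A *m (b + a *m v)) ^+ 2.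

Section residual_theory.
Variables (R : realType) (q : nat).
Implicit Types (A a : 'M[R]_q) (b v : 'cV[R]_q).

Lemma residual_ge0 A b a v : 0 <= residual A b a v.
Proof. exact: sqr_ge0. Qed.

Lemma residualZ k A b a v :
  residual A (k *: b) (k *: a) v = k ^+ 2 * residual A b a v.
Proof.
rewrite /residual -scalemxAl -scalerDr -scalemxAr !norm2_sqr mulr_sumr.
by apply: eq_bigr => i _; rewrite mxE exprMn.
Qed.

(** An affine map that is not identically zero does not vanish on a
    neighbourhood of 0: test it at 0, then on a small multiple of a basis vector
    picking a nonzero column of its linear part. *)
Lemma residual_neq0 A b a (r : R) : 0 < r -> A \in unitmx ->
  b != 0 \/ a != 0 -> exists2 v, cube 0 r v & 0 < residual A b a v.
Proof.
move=> r0 uA ba.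
suff [v vr nz] : exists2 v, cube (0 : 'cV[R]_q) r v & b + a *m v != 0.
  exists v => //; rewrite lt_neqAle residual_ge0 andbT eq_sym sqrf_eq0.
  apply: contra nz => /eqP/norm2_eq0 /(congr1 (mulmx (invmx A))).
  by rewrite mulKmx// mulmx0 => ->.
have [b0|bn0] := eqVneq b 0; last first.
  exists 0; last by rewrite mulmx0 addr0.
  by move=> i; rewrite subrr normr0.
have [j aj] : exists j, col j a != 0.
  apply/existsP; move: ba; rewrite b0 eqxx => -[//|]; apply: contraR.
  rewrite negb_exists => /forallP a0; apply/eqP/matrixP => i j.
  by have := a0 j; rewrite negbK => /eqP/colP/(_ i); rewrite !mxE.
exists ((r / 2) *: delta_mx j ord0).
  move=> i; rewrite !mxE sub0r normrN normrM (gtr0_norm (divr_gt0 _ _))//.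
  by case: (_ && _); rewrite ?normr1 ?normr0; lra.
rewrite b0 add0r -scalemxAr -colE scaler_eq0 negb_or aj andbT.
by rewrite mulf_neq0 ?gt_eqF// invr_gt0.
Qed.

Lemma continuous_residual n (A a : 'cV[R]_n -> 'M[R]_q) (b : 'cV[R]_n -> 'cV[R]_q) :
  mx_continuous A -> mx_continuous b -> mx_continuous a ->
  continuous (fun z : 'cV[R]_n * 'cV[R]_q => residual (A z.1) (b z.1) (a z.1) z.2).
Proof.
move=> cA cb ca.
pose M (z : 'cV[R]_n * 'cV[R]_q) := A z.1 *m (b z.1 + a z.1 *m z.2).
have cfst : continuous (@fst 'cV[R]_n 'cV[R]_q) by move=> z; exact: cvg_fst.
have csnd : continuous (@snd 'cV[R]_n 'cV[R]_q) by move=> z; exact: cvg_snd.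
have cM : mx_continuous M.
  apply: mx_continuousM; first exact: (mx_continuous_comp cfst cA).
  apply: mx_continuousD; first exact: (mx_continuous_comp cfst cb).
  apply: mx_continuousM; first exact: (mx_continuous_comp cfst ca).
  exact: continuous_mx_continuous.
rewrite (_ : (fun _ => _) = fun z => \sum_i M z i ord0 ^+ 2).
  apply: continuous_sum_ord => i z.
  apply: (@continuous_comp _ _ _ (fun z => M z i ord0) (fun x => x ^+ 2)).
    exact: cM.
  exact: exprn_continuous.
by apply/funext => z; rewrite /residual norm2_sqr.
Qed.

End residual_theory.

Section expected_residual.
Variables (R : realType) (n q : nat).
Variables (X : probability (borel R n) R) (V : probability (borel R q) R).
Hypothesis uniform_V : uniform_on V (@unit_ball2 R q).
Local Notation D := (prob_support X).
Local Notation B := (@unit_ball2 R q).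

Lemma null_outside_support : (X \x V)%E (~` D `*` setT) = 0%E.
Proof.
rewrite product_measure1E//.
  rewrite [Y in (Y * _)%E](_ : _ = 0%E) ?mul0e//; exact: prob_support_full.
by apply: measurableC; apply: borel_closed; exact: closed_prob_support.
Qed.

Lemma null_outside_ball : (X \x V)%E (setT `*` ~` B) = 0%E.
Proof.
rewrite product_measure1E//.
  rewrite [Y in (_ * Y)%E](_ : _ = 0%E) ?mule0//.
  exact: uniform_unit_ball2_out.
by apply: measurableC; apply: borel_closed; exact: closed_unit_ball2.
Qed.

(** Only the values on D times the unit ball count: the product measure of the
    complement is 0. *)
Lemma ge0_le_integral_support (f g : borel R n * borel R q -> \bar R) :
  (forall z, 0 <= f z)%E -> (forall z, 0 <= g z)%E ->
  (forall x v, D x -> B v -> (f (x, v) <= g (x, v))%E) ->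
  (\int[X \x V]_z f z <= \int[X \x V]_z g z)%E.
Proof.
move=> f0 g0 fg.
have mD : measurable (~` D `*` setT : set (borel R n * borel R q)).
  apply: measurableX => //.
  by apply: measurableC; apply: borel_closed; exact: closed_prob_support.
have mB : measurable (setT `*` ~` B : set (borel R n * borel R q)).
  apply: measurableX => //.
  by apply: measurableC; apply: borel_closed; exact: closed_unit_ball2.
pose N : set (borel R n * borel R q) := ~` D `*` setT `|` setT `*` ~` B.
apply: (@ge0_le_integral_off_null _ _ _ _ N) => //.
- exact: measurableU.
- by apply: null_set_setU => //;
    [exact: null_outside_support|exact: null_outside_ball].
- move=> [x v] /not_orP[/= nD nB]; apply: fg.
    by apply: contrapT => nDx; apply: nD.
  by apply: contrapT => nBv; apply: nB.
Qed.

Variables (A a : 'cV[R]_n -> 'M[R]_q) (b : 'cV[R]_n -> 'cV[R]_q).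
Hypotheses (cA : mx_continuous A) (cb : mx_continuous b) (ca : mx_continuous a).

Lemma expected_residual_lty : compact D ->
  (\int[X \x V]_z (residual (A z.1) (b z.1) (a z.1) z.2)%:E < +oo)%E.
Proof.
move=> cptD.
have cDB := compact_setX cptD (@compact_unit_ball2 R q).
have := @continuous_compact _ _ _ _ (continuous_subspaceT
  (continuous_residual cA cb ca)) cDB.
move=> /compact_bounded[M [_ /(_ (Num.max M 0 + 1))]].
have M1 : M < Num.max M 0 + 1 by rewrite ltr_pwDr// le_max lexx.
move=> /(_ M1) leM.
have M0 : 0 <= Num.max M 0 + 1 by rewrite addr_ge0// le_max lexx orbT.
apply: (@le_lt_trans _ _ (\int[X \x V]_z (Num.max M 0 + 1)%:E)%E).
  apply: ge0_le_integral_support => [z|z|x v Dx Bv]; rewrite lee_fin//.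
    exact: residual_ge0.
  apply: le_trans (ler_norm _) _; apply: leM.
  by exists (x, v).
rewrite integral_cst// [Y in (_ * Y)%E](_ : _ = 1%E) ?mule1 ?ltry//.
exact: (@probability_setT _ _ _ (X \x V)%E).
Qed.

(** The residual is at least e on an open rectangle around (x0, v0), which has
    positive measure. *)
Lemma expected_residual_gt0 (x0 : 'cV[R]_n) : D x0 -> A x0 \in unitmx ->
  b x0 != 0 \/ a x0 != 0 ->
  (0 < \int[X \x V]_z (residual (A z.1) (b z.1) (a z.1) z.2)%:E)%E.
Proof.
move=> Dx0 uA ba.
have [r r0 rB] := cube_sub_unit_ball2 R q.
have [v0 v0r res0] := residual_neq0 r0 uA ba.
set e := residual (A x0) (b x0) (a x0) v0 / 2.
have e0 : 0 < e by rewrite divr_gt0.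
have : nbhs (x0, v0) [set z | e < residual (A z.1) (b z.1) (a z.1) z.2].
  have er : e < residual (A x0) (b x0) (a x0) v0 by rewrite /e; lra.
  exact: (continuous_residual cA cb ca (x := (x0, v0))) (lt_nbhsr er).
move=> [[U W] /= [nU nW] UW].
have [s s0 sW] : exists2 s, 0 < s & cube v0 s `<=` W `&` cube 0 r.
  apply: nbhs_cube; apply: filterI => //.
  by apply: open_nbhs_nbhs; split => //; exact: open_cube.
have mU : measurable (U° : set (borel R n)).
  by apply: borel_open; exact: open_interior.
have mC : measurable (cube v0 s : set (borel R q)).
  by apply: borel_open; exact: open_cube.
have mUC : measurable (U° `*` cube v0 s : set (borel R n * borel R q)).
  exact: measurableX.
apply: (@lt_le_trans _ _ (\int[X \x V]_z (e%:E * (\1_(U° `*` cube v0 s) z)%:E))%E).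
  rewrite ge0_integralZl//; last 2 first.
  - by apply: measurableT_comp => //; exact: measurable_indic.
  - by rewrite lee_fin ltW.
  rewrite integral_indic// setIT.
  rewrite [Y in (_ * Y)%E](_ : _ = (X U° * V (cube v0 s))%E); last first.
    exact: product_measure1E.
  rewrite !mule_gt0 ?lte_fin//.
    by apply: Dx0 => //; exact: open_interior.
  apply: uniform_unit_ball2_cube_gt0 => // v /sW[_]; exact: rB.
apply: ge0_le_integral_lower => -[x v] /=.
  by rewrite mule_ge0// lee_fin// ltW.
rewrite -EFinM lee_fin indicE.
have [UCx|] := pselect ((U° `*` cube v0 s) (x, v)); last first.
  by move=> nUC; rewrite memNset// mulr0; exact: residual_ge0.
rewrite (mem_set UCx) mulr1 ltW//; apply: (UW (x, v)).
by case: UCx => /= /interior_subset ? /sW[].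
Qed.

End expected_residual.

(** * Minimizers of functions decreasing along segments *)

(** If moving from any t towards theta strictly decreases L at once, points with
    smaller values exist in every neighbourhood of t, so t is not a local
    minimizer. *)
Lemma segment_descent_minimizers (R : realType) (E : normedModType R)
    (C : set E) (L : E -> \bar R) (theta : E) :
  C theta ->
  (forall t (k : R), C t -> 0 < k < 1 -> C (theta + k *: (t - theta))) ->
  (forall t, (L theta <= L t)%E) ->
  (forall t (k : R), t != theta -> 0 < k < 1 ->
    (L (theta + k *: (t - theta))%R < L t)%E) ->
  (forall t, global_minimizer C L t <-> t = theta) /\
  (forall t, local_minimizer C L t <-> t = theta).
Proof.
move=> Cth Cseg Lth descent.
have glob_loc t : global_minimizer C L t -> local_minimizer C L t.
  move=> [Ct minL]; split=> //.
  suff : nbhs t [set s | C s -> (L t <= L s)%E] by [].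
  by apply: filterE => s; exact: minL.
have glob : global_minimizer C L theta by split.
have loc t : local_minimizer C L t -> t = theta.
  move=> [Ct nearL]; apply/eqP; apply: contraT => tth.
  pose g (k : R) : E := theta + k *: (t - theta).
  have cg : {for 1, continuous g}.
    apply: cvgD; first exact: cvg_cst.
    exact: scalel_continuous.
  have nL : nbhs (g 1) [set s | C s -> (L t <= L s)%E].
    by rewrite /g scale1r addrC subrK.
  have /nbhs_ballP[e /= e0 eL] := cg _ nL.
  have [k /andP[k0 k1] ke] : exists2 k : R, 0 < k < 1 & ball (1 : R) e k.
    exists (1 - Num.min e 1 / 2).
      have : 0 < Num.min e 1 <= 1 by rewrite lt_min e0 ltr01 ge_min lexx orbT.
      by move=> /andP[? ?]; apply/andP; split; lra.
    have m0 : 0 < Num.min e 1 by rewrite lt_min e0 ltr01.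
    have me : Num.min e 1 <= e by rewrite ge_min lexx.
    by rewrite /ball /= opprB addrC subrK gtr0_norm; lra.
  have kk : 0 < k < 1 by rewrite k0.
  have := eL k ke (Cseg t k Ct kk).
  by rewrite leNgt descent.
split=> t; split=> [|->//].
- by move=> /glob_loc/loc.
- exact: loc.
- exact: glob_loc.
Qed.

(** * The loss near an exact parameter *)

Section lin_comb_theory.
Variables (R : realType) (T : Type) (W : lmodType R) (K : nat).
Variable F : 'I_K -> T -> W.

Lemma lin_combZ (k : R) (c : 'cV[R]_K) x :
  lin_comb (k *: c) F x = k *: lin_comb c F x.
Proof.
by rewrite /lin_comb scaler_sumr; apply: eq_bigr => i _; rewrite mxE scalerA.
Qed.

Lemma lin_combB (c d : 'cV[R]_K) x :
  lin_comb (c - d) F x = lin_comb c F x - lin_comb d F x.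
Proof.
rewrite /lin_comb -sumrB; apply: eq_bigr => i _.
by rewrite !mxE scalerBl.
Qed.

Lemma lin_indep_on_neq0 (D : set T) (c : 'cV[R]_K) :
  lin_indep_on D F -> c != 0 -> exists2 x, D x & lin_comb c F x != 0.
Proof.
move=> indep c0; apply: contrapT => no; move/eqP: c0; apply; apply: indep => x Dx.
by apply/eqP; apply: contrapT => /negP nz; apply: no; exists x.
Qed.

End lin_comb_theory.

Lemma segment_convex_set (R : realType) (K : nat) (S : set 'cV[R]_K) s t (k : R) :
  convex_set S -> S s -> S t -> 0 < k < 1 -> S (s + k *: (t - s)).
Proof.
move=> cS Ss St /andP[k0 k1].
have := cS t s (Itv01 (ltW k0) (ltW k1)) (mem_set St) (mem_set Ss).
rewrite inE; congr (S _).
change (k *: t + (1 - k) *: s = s + k *: (t - s)).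
by rewrite scalerBl scale1r scalerBr addrCA addrA.
Qed.

Lemma norm2N (R : realType) q (v : 'cV[R]_q) : norm2 (- v) = norm2 v.
Proof.
by rewrite /norm2; congr Num.sqrt; apply: eq_bigr => i _; rewrite mxE sqrrN.
Qed.

(** Exactness at theta means v = drift + A u_theta(x, v), so that
    v - (drift + A u_t(x, v)) = - A (u_t - u_theta)(x, v), and the terms of the
    nominal model cancel in the difference of controllers. *)
Lemma pointwise_loss_residual (R : realType) (n q K1 K2 : nat)
    (plant : control_system R n q) (model : option (control_system R n q))
    (gamma : 'I_q -> nat)
    (beta : 'I_K1 -> 'cV[R]_n -> 'cV[R]_q)
    (alpha : 'I_K2 -> 'cV[R]_n -> 'M[R]_q)
    (theta t : 'cV[R]_K1 * 'cV[R]_K2) (x : 'cV[R]_n) (v : 'cV[R]_q) :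
  decoupling_mx plant gamma x \in unitmx ->
  learned_controller model gamma beta alpha theta x v =
    linearizing_controller plant gamma x v ->
  pointwise_loss plant gamma (learned_controller model gamma beta alpha t) x v =
  residual (decoupling_mx plant gamma x) (lin_comb (t - theta).1 beta x)
    (lin_comb (t - theta).2 alpha x) v.
Proof.
move=> uA exact_theta; rewrite /pointwise_loss /residual -norm2N.
set A := decoupling_mx plant gamma x; set b := drift_term plant gamma x.
have v_eq : v = b + A *m learned_controller model gamma beta alpha theta x v.
  by rewrite exact_theta /linearizing_controller mulKVmx// addrC addrAC addNr add0r.
rewrite [X in norm2 (- (X - _))]v_eq opprB addrAC opprD addrA subrr add0r.
rewrite addrC -mulmxBr /learned_controller.
rewrite [(t - theta).1]/= [(t - theta).2]/= !lin_combB.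
congr (norm2 (A *m _) ^+ 2).
rewrite opprD addrACA -mulmxBl.
rewrite (addrC (model_beta _ _ _) (lin_comb t.1 _ _)) addrKA.
by rewrite (addrC (model_alpha _ _ _) (lin_comb t.2 _ _)) addrKA.
Qed.

Theorem theorem1 (R : realType) (n q K1 K2 : nat)
    (n_gt0 : (0 < n)%N) (q_gt0 : (0 < q)%N)
    (D : set 'cV[R]_n) (compact_D : compact D)
    (plant : control_system R n q) (model : option (control_system R n q))
    (gamma : 'I_q -> nat)
    (smooth_plant : smooth_system plant)
    (degree_plant : vector_relative_degree plant D gamma)
    (smooth_model : forall sys, model = Some sys -> smooth_system sys)
    (degree_model : forall sys, model = Some sys ->
       vector_relative_degree sys D gamma)
    (Theta1 : set 'cV[R]_K1) (Theta2 : set 'cV[R]_K2)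
    (convex_Theta1 : convex_set Theta1) (convex_Theta2 : convex_set Theta2)
    (beta : 'I_K1 -> 'cV[R]_n -> 'cV[R]_q)
    (alpha : 'I_K2 -> 'cV[R]_n -> 'M[R]_q)
    (continuous_beta : forall k, continuous (beta k))
    (continuous_alpha : forall k, continuous (alpha k))
    (indep_beta : lin_indep_on D beta)
    (indep_alpha : lin_indep_on D alpha)
    (X : probability (borel R n) R) (support_X : prob_support X = D)
    (V : probability (borel R q) R) (uniform_V : uniform_on V (@unit_ball2 R q))
    (theta : 'cV[R]_K1 * 'cV[R]_K2) (theta_in : (Theta1 `*` Theta2) theta)
    (exact_theta : forall x v, D x ->
       learned_controller model gamma beta alpha theta x v =
       linearizing_controller plant gamma x v) :
  let L := expected_loss plant model gamma beta alpha X V in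
  (forall t, global_minimizer (Theta1 `*` Theta2) L t <-> t = theta) /\
  (forall t, local_minimizer (Theta1 `*` Theta2) L t <-> t = theta).
Proof.
move=> L; subst D.
pose A := decoupling_mx plant gamma.
pose res (d : 'cV[R]_K1 * 'cV[R]_K2) (z : borel R n * borel R q) : \bar R :=
  (residual (A z.1) (lin_comb d.1 beta z.1) (lin_comb d.2 alpha z.1) z.2)%:E.
have res0 d z : (0 <= res d z)%E by rewrite lee_fin residual_ge0.
have loss0 t z : (0 <= (pointwise_loss plant gamma
    (learned_controller model gamma beta alpha t) z.1 z.2)%:E)%E.
  by rewrite lee_fin; exact: sqr_ge0.
have uA x : prob_support X x -> A x \in unitmx.
  by case: degree_plant => _ _ [c _ Ac] /Ac[].
have lossE t x v : prob_support X x ->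
    pointwise_loss plant gamma (learned_controller model gamma beta alpha t) x v =
    residual (A x) (lin_comb (t - theta).1 beta x)
      (lin_comb (t - theta).2 alpha x) v.
  move=> Sx; apply: pointwise_loss_residual; first exact: uA.
  exact: exact_theta.
(* Both inequalities hold because the two integrands agree on D. *)
have LE t : L t = (\int[X \x V]_z res (t - theta)%R z)%E.
  rewrite /L /expected_loss unlock; apply/eqP; rewrite eq_le; apply/andP; split;
  by apply: ge0_le_integral_support => // x v Sx _; rewrite /res /= lossE.
have cA : mx_continuous A by move=> i j; exact: decoupling_mx_continuous.
have cb (d : 'cV[R]_K1 * 'cV[R]_K2) : mx_continuous (lin_comb d.1 beta).
  exact: mx_continuous_lin_comb.
have ca (d : 'cV[R]_K1 * 'cV[R]_K2) : mx_continuous (lin_comb d.2 alpha).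
  exact: mx_continuous_lin_comb.
have Ltheta : L theta = 0%E.
  rewrite LE subrr; apply: integral0_eq => z _; rewrite /res.
  rewrite -[0 : 'cV_K1 * 'cV_K2](scale0r (0 : 'cV[R]_K1 * 'cV[R]_K2)) /=.
  by rewrite !lin_combZ residualZ expr0n mul0r.
have L_gt0 t : t != theta -> (0 < L t)%E.
  rewrite LE -subr_eq0; set d := t - theta => dn0.
  have [x Sx nz] : exists2 x, prob_support X x &
      lin_comb d.1 beta x != 0 \/ lin_comb d.2 alpha x != 0.
    have [d1|d1] := eqVneq d.1 0.
      have d2 : d.2 != 0.
        by apply: contra dn0 => /eqP d2; rewrite [d]surjective_pairing d1 d2.
      have [x Sx nz] := lin_indep_on_neq0 indep_alpha d2.
      by exists x => //; right.
    have [x Sx nz] := lin_indep_on_neq0 indep_beta d1.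
    by exists x => //; left.
  exact: (expected_residual_gt0 uniform_V cA (cb d) (ca d) Sx (uA x Sx) nz).
have L_lty t : (L t < +oo)%E.
  by rewrite LE; apply: expected_residual_lty.
(* The displacement of theta + k (t - theta) from theta is k (t - theta). *)
have L_segment t k : 0 < k ->
    (L (theta + k *: (t - theta))%R <= (k ^+ 2)%:E * L t)%E.
  move=> k0; rewrite !LE (addrC theta) addrK.
  apply: le_trans (ge0_integralZl_le _ _ _); last 2 first.
  - by rewrite exprn_gt0.
  - exact: res0.
  apply: ge0_le_integral_lower => // z.
  by rewrite /res /= !lin_combZ residualZ EFinM.
apply: segment_descent_minimizers => //.
- move=> t k [t1 t2] kk; have [th1 th2] := theta_in.
  by split; apply: segment_convex_set.
- by move=> t; rewrite Ltheta LE; apply: integral_ge0.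
- move=> t k tth /andP[k0 k1]; apply: le_lt_trans (L_segment t k k0) _.
  have := L_lty t; have := L_gt0 t tth.
  case: (L t) => [l||]//; rewrite !lte_fin => l0 _.
  by rewrite gtr_pMl// expr_lt1// ltW.
Qed.
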